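(* Let $n\ge 2$, let $m\ge 1$ be an integer, and let $H_1,H_2\in B_n$ be half-twists with $H_1^m=H_2^m$. Then $H_1=H_2$.
   Context: $B_n$ is Artin's braid group with generators $\sigma_1,\dots,\sigma_{n-1}$ and relations $\sigma_i\sigma_j=\sigma_j\sigma_i$ for $|i-j|\ge 2$ and $\sigma_i\sigma_{i+1}\sigma_i=\sigma_{i+1}\sigma_i\sigma_{i+1}$. A half-twist is an element of the conjugacy class of $\sigma_1$ in $B_n$, i.e. an element $q^{-1}\sigma_1 q$ with $q\in B_n$. *)

(* Defs.v *)
From mathcomp Require Import all_boot.
Set Implicit Arguments. Unset Strict Implicit. Unset Printing Implicit Defensive.

(* A letter is a generator sigma_{i+1} (i : 'I_(n.-1)) with an inversion flag
   (false = sigma_{i+1}, true = sigma_{i+1}^-1). *)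
Definition letter (n : nat) := ('I_n.-1 * bool)%type.
Definition word (n : nat) := seq (letter n).

Definition inv_letter n (x : letter n) : letter n := (x.1, ~~ x.2).
Definition inv_word n (w : word n) : word n := rev (map (@inv_letter n) w).

Definition word_pow n (w : word n) (m : nat) : word n := flatten (nseq m w).

(* Equality in B_n: the smallest congruence on words (w.r.t. concatenation)
   containing free cancellation and the braid relations. *)
Inductive braid_eq (n : nat) : word n -> word n -> Prop :=
| be_refl u : braid_eq u u
| be_sym u v : braid_eq u v -> braid_eq v u
| be_trans u v w : braid_eq u v -> braid_eq v w -> braid_eq u w
| be_cat u u' v v' : braid_eq u u' -> braid_eq v v' -> braid_eq (u ++ v) (u' ++ v')
| be_free (x : letter n) : braid_eq [:: x; inv_letter x] [::]
| be_comm (i j : 'I_n.-1) : (i.+1 < j) || (j.+1 < i) ->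
    braid_eq [:: (i, false); (j, false)] [:: (j, false); (i, false)]
| be_braid (i j : 'I_n.-1) : val j = (val i).+1 ->
    braid_eq [:: (i, false); (j, false); (i, false)]
             [:: (j, false); (i, false); (j, false)].

Definition is_half_twist n (h : word n) : Prop :=
  exists (i : 'I_n.-1) (q : word n),
    val i = 0 /\ braid_eq h (inv_word q ++ [:: (i, false)] ++ q).

(* Main.v *)
Require Import Defs.
From Stdlib Require Import Setoid Morphisms.
From mathcomp Require Import all_boot zify.
Set Implicit Arguments. Unset Strict Implicit. Unset Printing Implicit Defensive.

(** Since [H1] and [H2] are conjugate to generators, the theorem says that
    [i^m q = q j^m] implies [i q = q j] for generators [i], [j] and a braid [q].
    The full twist [(s_1 ... s_(n-1))^n] is central and divisible by every
    generator, so multiplying by its powers reduces this to positive [q] and to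
    an equality in the positive braid monoid, which embeds in the group because
    it is left cancellative.  There one inducts on the length of [q = k q'].
    If [k = i] or [k] commutes with [i], cancel [k].  If [k] is adjacent to [i],
    then [lcm(i^m, k) = i^m k i] divides [i^m q], so [q = k i z] with
    [k^m z = z j^m], and the relation [i k i = k i k] transports the conclusion
    from [z] to [q].  Both cancellation and the lcm property are Garside's lemma
    [artin_eq_lcm], which holds in the Artin monoid of any graph with labels
    [2] and [3] only. *)

Section ArtinMonoid.
Variables (T : eqType) (adj : rel T).
Implicit Types (i j k p : T) (u v w x y z t : seq T).

Definition far i j : bool := (i != j) && ~~ adj i j.

Inductive artin_eq : seq T -> seq T -> Prop :=
| artin_refl u : artin_eq u u
| artin_sym u v : artin_eq u v -> artin_eq v u
| artin_trans u v w : artin_eq u v -> artin_eq v w -> artin_eq u w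
| artin_cons i u v : artin_eq u v -> artin_eq (i :: u) (i :: v)
| artin_comm i j u : far i j -> artin_eq (i :: j :: u) (j :: i :: u)
| artin_braid i j u : adj i j -> artin_eq (i :: j :: i :: u) (j :: i :: j :: u).

Local Notation "u =+ v" := (artin_eq u v) (at level 70).

#[local] Hint Resolve artin_refl : core.

#[export] Instance artin_eq_equiv : Equivalence artin_eq.
Proof. split; [exact: artin_refl | exact: artin_sym | exact: artin_trans]. Qed.

#[export] Instance cons_artin_eq : Proper (eq ==> artin_eq ==> artin_eq) cons.
Proof. by move=> i _ <- u v; apply: artin_cons. Qed.

Lemma artin_eq_catr w u v : u =+ v -> u ++ w =+ v ++ w.
Proof.
elim=> {u v} [u|u v _ ?|u v t _ ? _ ?|i u v _ ?|i j u ?|i j u ?] /=.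
- by [].
- by symmetry.
- by transitivity (v ++ w).
- exact: artin_cons.
- exact: artin_comm.
- exact: artin_braid.
Qed.

#[export] Instance cat_artin_eq :
  Proper (artin_eq ==> artin_eq ==> artin_eq) cat.
Proof.
move=> u u' uu' v v' vv'; transitivity (u' ++ v); first exact: artin_eq_catr.
by elim: u' {uu'} => //= i u' IH; apply: artin_cons.
Qed.

Lemma artin_eq_size u v : u =+ v -> size u = size v.
Proof. by elim=> //= {u v} [u v w _ -> _ ->|i u v _ ->]. Qed.

Lemma artin_eq_mem u v : u =+ v -> u =i v.
Proof.
elim=> {u v} [u|u v _ uv|u v w _ uv _ vw|i u v _ uv|i j u _|i j u _] a //.
- by rewrite uv vw.
- by rewrite !inE uv.
- by rewrite !inE orbCA.
- by rewrite !inE; do 2!case: eqP.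
Qed.

Lemma artin_eq_far_cat i w t : all (far i) w -> i :: w ++ t =+ w ++ i :: t.
Proof. by elim: w => //= j w IH /andP[ij /IH <-]; apply: artin_comm. Qed.

Lemma artin_eq_pow_braid i k m t : adj i k ->
  nseq m i ++ k :: i :: t =+ k :: i :: nseq m k ++ t.
Proof. by move=> ik; elim: m => //= m ->; rewrite (artin_braid _ ik). Qed.

(* [i :: complement i k] spells the lcm of [i] and [k]. *)
Definition complement i k : seq T :=
  if i == k then [::] else if adj i k then [:: k; i] else [:: k].

Definition lcm_factors i k x y : Prop :=
  exists z, x =+ complement i k ++ z /\ y =+ complement k i ++ z.

Definition head_compatible u v : Prop :=
  match u, v with
  | [::], [::] => True
  | i :: x, k :: y => lcm_factors i k x y
  | _, _ => False
  end.

Lemma lcm_factors_sym i k x y : lcm_factors i k x y -> lcm_factors k i y x.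
Proof. by case=> z [xz yz]; exists z. Qed.

Lemma complementxx i : complement i i = [::].
Proof. by rewrite /complement eqxx. Qed.

Lemma lcm_factorsxx i x y : lcm_factors i i x y <-> x =+ y.
Proof.
rewrite /lcm_factors complementxx; split=> [[z [-> ->]] //|xy].
by exists y.
Qed.

Lemma complement_far i k : far i k -> complement i k = [:: k].
Proof. by rewrite /complement => /andP[/negPf-> /negPf->]. Qed.

Hypotheses (adj_sym : symmetric adj) (adj_irr : irreflexive adj).

Lemma adj_neq i k : adj i k -> i != k.
Proof. by apply: contraTneq => ->; rewrite adj_irr. Qed.

Lemma far_sym : symmetric far.
Proof. by move=> i k; rewrite /far eq_sym adj_sym. Qed.

Variant adj_spec i k : Prop :=
| AdjEq of i = k
| AdjAdj of adj i k & adj k i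
| AdjFar of far i k & far k i.

Lemma adjP i k : adj_spec i k.
Proof.
have [|neq_ik] := eqVneq i k; first exact: AdjEq.
have [ik|not_ik] := boolP (adj i k); first by apply: AdjAdj; rewrite // adj_sym.
have ik : far i k by rewrite /far neq_ik.
by apply: AdjFar; rewrite // far_sym.
Qed.

Lemma complement_adj i k : adj i k -> complement i k = [:: k; i].
Proof. by move=> ik; rewrite /complement (negPf (adj_neq ik)) ik. Qed.

Lemma lcm_factors_far i k x y : far i k ->
  lcm_factors i k x y <-> exists z, x =+ k :: z /\ y =+ i :: z.
Proof.
by move=> ik; rewrite /lcm_factors !complement_far // far_sym.
Qed.

Lemma lcm_factors_adj i k x y : adj i k ->
  lcm_factors i k x y <-> exists z, x =+ k :: i :: z /\ y =+ i :: k :: z.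
Proof.
by move=> ik; rewrite /lcm_factors !complement_adj // adj_sym.
Qed.

Lemma far_complement p i k : far p i -> far p k -> all (far p) (complement i k).
Proof.
by move=> pi pk; rewrite /complement; do 2?case: ifP; rewrite /= ?pi ?pk.
Qed.

Section Cube.
Variable L : nat.
Hypothesis garside_below : forall i k x y,
  i :: x =+ k :: y -> size x < L -> lcm_factors i k x y.

Ltac solve_size :=
  repeat match goal with uv : artin_eq _ _ |- _ =>
    apply artin_eq_size in uv; simpl in uv end; simpl in *; lia.

Lemma far_below i k x y : far i k -> i :: x =+ k :: y -> size x < L ->
  exists z, x =+ k :: z /\ y =+ i :: z.
Proof. by move=> ik xy sx; apply/lcm_factors_far/garside_below. Qed.

Lemma adj_below i k x y : adj i k -> i :: x =+ k :: y -> size x < L ->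
  exists z, x =+ k :: i :: z /\ y =+ i :: k :: z.
Proof. by move=> ik xy sx; apply/lcm_factors_adj/garside_below. Qed.

Lemma cancel_below w x y : w ++ x =+ w ++ y -> size (w ++ x) <= L -> x =+ y.
Proof.
elim: w => //= i w IH xy sx; apply: IH (ltnW sx).
exact/(lcm_factorsxx i)/garside_below.
Qed.

(* Three pairwise adjacent generators have no common multiple: a relation
   [a u = b c v] yields the shorter relation [c v = a b z]. *)
Lemma triangle_no_multiple a b c u v : adj a b -> adj b c -> adj c a ->
  size u < L -> ~ a :: u =+ b :: c :: v.
Proof.
have [l] := ubnP (size u).
elim: l a b c u v => // l IH a b c u v sl ab bc ca su uv.
have [z [_ vz]] := adj_below ab uv su.
by apply: (IH c a b v z) vz => //; solve_size.
Qed.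

Lemma cube_adj_adj i p k z z' : adj i p -> adj p k -> i != k ->
  size (i :: p :: z) <= L -> i :: p :: z =+ k :: p :: z' ->
  lcm_factors i k (p :: i :: z) (p :: k :: z').
Proof.
move=> ip pk neq_ik sz zz'; have pi : adj p i by rewrite adj_sym.
case: (adjP i k) neq_ik => [->|ik _ _|ik ki _]; first by rewrite eqxx.
  by case: (triangle_no_multiple ik _ pi _ zz'); rewrite // adj_sym.
have [|t [zt z't]] := far_below ik zz'; first by solve_size.
have [|s [zs ts]] := adj_below pk zt; first by solve_size.
have [|r [z'r tr]] := adj_below pi z't; first by solve_size.
have sr : k :: s =+ i :: r.
  by apply: (@cancel_below [:: p]); [rewrite /= -ts | solve_size].
have [|q [sq rq]] := far_below ki sr; first by solve_size.
apply/(lcm_factors_far _ _ ik); exists (p :: i :: k :: p :: q); split.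
  rewrite zs sq (artin_comm (p :: i :: q) ik) (artin_braid q ip).
  by rewrite (artin_braid _ pk) (artin_comm (p :: q) ki).
rewrite z'r rq (artin_comm (p :: k :: q) ki) -(artin_braid q pk).
by rewrite (artin_braid _ pi).
Qed.

Lemma cube_far_adj i p k z z' : far i p -> adj p k -> i != k ->
  size (i :: z) <= L -> i :: z =+ k :: p :: z' ->
  lcm_factors i k (p :: z) (p :: k :: z').
Proof.
move=> ip pk neq_ik sz zz'; have pi : far p i by rewrite far_sym.
case: (adjP i k) neq_ik => [->|ik _ _|ik _ _]; first by rewrite eqxx.
  have [|t [zt z't]] := adj_below ik zz'; first by solve_size.
  have [|s [z's ts]] := far_below pi z't; first by solve_size.
  have kp : adj k p by rewrite adj_sym.
  have [|r [tr sr]] := adj_below kp ts; first by solve_size.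
  apply/(lcm_factors_adj _ _ ik); exists (p :: k :: i :: r); split.
    rewrite zt tr (artin_comm (k :: r) ip) (artin_braid _ pk).
    by rewrite -(artin_braid r ik) (artin_comm (k :: i :: r) pi).
  rewrite z's sr -(artin_braid _ ik) (artin_comm _ pi).
  by rewrite (artin_comm r ip) (artin_braid _ pk).
have [|t [zt z't]] := far_below ik zz'; first by solve_size.
have [|s [z's ts]] := far_below pi z't; first by solve_size.
apply/(lcm_factors_far _ _ ik); exists (p :: k :: s); split.
  by rewrite zt ts (artin_braid _ pk).
by rewrite z's -(artin_comm _ ik) (artin_comm _ pi).
Qed.

Lemma cube_far_far i p k z z' : far p i -> far p k ->
  size (i :: z) <= L -> i :: z =+ k :: z' ->
  lcm_factors i k (p :: z) (p :: z').
Proof.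
move=> pi pk sz zz'; have [|t [zt z't]] := garside_below zz'; first by [].
by exists (p :: t); rewrite zt z't !artin_eq_far_cat ?far_complement.
Qed.

(* Writing [i\p] for [complement i p], the hypothesis is the middle equality of
   [i (i\p) z = p (p\i) z = p (p\k) z' = k (k\p) z']. *)
Lemma lcm_factors_cube i p k z z' : size (complement p i ++ z) <= L ->
  complement p i ++ z =+ complement p k ++ z' ->
  lcm_factors i k (complement i p ++ z) (complement k p ++ z').
Proof.
have [<-|neq_ik] := eqVneq i k.
  by move=> sz zz'; apply/lcm_factorsxx; rewrite (cancel_below zz' sz).
case: (adjP i p) => [<-|ip pi|ip pi].
- by rewrite complementxx => _ zz'; exists z'.
- case: (adjP p k) => [<-|pk kp|pk kp].
  + by rewrite complementxx => _ zz'; exists z; split=> //; symmetry.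
  + by rewrite !complement_adj //; apply: cube_adj_adj.
  + rewrite !(complement_adj ip, complement_adj pi) !complement_far // => sz zz'.
    apply/lcm_factors_sym/cube_far_adj => //; first by rewrite eq_sym.
      by move: sz; rewrite (artin_eq_size zz').
    by symmetry.
- case: (adjP p k) => [<-|pk kp|pk kp].
  + by rewrite complementxx => _ zz'; exists z; split=> //; symmetry.
  + rewrite !(complement_far ip, complement_far pi) !complement_adj //.
    exact: cube_far_adj.
  + by rewrite !complement_far //; apply: cube_far_far.
Qed.

Lemma lcm_factors_trans i p k x w y : size w <= L ->
  lcm_factors i p x w -> lcm_factors p k w y -> lcm_factors i k x y.
Proof.
move=> sw [z [xz wz]] [z' [wz' yz']].
have [||t [zt z't]] := @lcm_factors_cube i p k z z'.
- by rewrite -(artin_eq_size wz).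
- by rewrite -wz.
by exists t; rewrite xz yz'.
Qed.

End Cube.

Lemma artin_eq_head_compatible u v : u =+ v -> head_compatible u v.
Proof.
have [L] := ubnP (size u); elim: L u v => // L IHL u v /[swap].
elim=> {u v} [[|i u] _|u v uv IH sv|u v w uv IHuv vw IHvw su
    |i u v uv _ _|i j u ij _|i j u ij _] //=.
- exact/lcm_factorsxx.
- move: IH; rewrite (artin_eq_size uv) => /(_ sv).
  by case: u v {uv sv} => [|i u] [|j v] //=; apply: lcm_factors_sym.
- have {IHuv} := IHuv su; rewrite (artin_eq_size uv) in su.
  have {IHvw} := IHvw su.
  case: u v w {uv vw} su => [|i u] [|p v] [|k w] //= sv pk ip.
  apply: (@lcm_factors_trans (size v)) ip pk => // a b x y xy sx.
  by apply: (IHL (a :: x) (b :: y)) xy => /=; lia.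
- exact/lcm_factorsxx.
- by apply/(lcm_factors_far _ _ ij); exists u.
- by apply/(lcm_factors_adj _ _ ij); exists u.
Qed.

Lemma artin_eq_lcm i k x y : i :: x =+ k :: y -> lcm_factors i k x y.
Proof. exact: artin_eq_head_compatible. Qed.

Lemma artin_eq_cancel w u v : w ++ u =+ w ++ v -> u =+ v.
Proof. by elim: w => //= i w IH /artin_eq_lcm/lcm_factorsxx/IH. Qed.

(* [lcm(i^m, k) = i^m k i] when [i] and [k] are adjacent. *)
Lemma artin_eq_pow_lcm i k m x y : adj i k -> 0 < m ->
  nseq m i ++ x =+ k :: y -> exists z, x =+ k :: i :: z.
Proof.
move=> ik; elim: m y => // m IH y _ /= /artin_eq_lcm.
case/(lcm_factors_adj _ _ ik)=> z [xz _].
by case: m IH xz => [_ /= xz|m IH /IH]; [exists z | apply].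
Qed.

Lemma artin_eq_conj_pow q i j m : 0 < m ->
  nseq m i ++ q =+ q ++ nseq m j -> i :: q =+ q ++ [:: j].
Proof.
move=> m_gt0; have [L] := ubnP (size q); elim: L q i => // L IH [|k q] i /=.
  move=> _ /artin_eq_mem/(_ i).
  by rewrite cats0 !mem_nseq m_gt0 eqxx => /esym/eqP->.
rewrite ltnS => sq iq; case: (adjP i k) iq => [<-|ik _|ik ki] iq.
- apply/artin_cons/IH => //.
  apply: (@artin_eq_cancel [:: i]); rewrite /= -iq.
  by rewrite -[i :: q]/(nseq 1 i ++ q) catA -nseqD addn1.
- have [z /(@artin_eq_cancel [:: k]) qz] := artin_eq_pow_lcm ik m_gt0 iq.
  rewrite qz (artin_braid _ ik) /=; do 2!apply: artin_cons; apply: IH.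
    by move/artin_eq_size: qz sq => /= ->; lia.
  apply: (@artin_eq_cancel [:: k; i]) => /=.
  by rewrite -artin_eq_pow_braid // -qz iq qz.
- rewrite (artin_comm _ ik); apply/artin_cons/IH => //.
  apply: (@artin_eq_cancel [:: k]); rewrite /= -iq artin_eq_far_cat //.
  by rewrite all_nseq ki orbT.
Qed.

End ArtinMonoid.

Definition consecutive N (i j : 'I_N) : bool :=
  (j == i.+1 :> nat) || (i == j.+1 :> nat).

Lemma consecutive_sym N : symmetric (@consecutive N).
Proof. by move=> i j; rewrite /consecutive orbC. Qed.

Lemma consecutive_irr N : irreflexive (@consecutive N).
Proof. by move=> i; rewrite /consecutive; lia. Qed.

Notation "u =+ v" := (artin_eq (@consecutive _) u v) (at level 70).

#[local] Hint Resolve artin_refl : core.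

Lemma positive_braid_cancel N (w u v : seq 'I_N) : w ++ u =+ w ++ v -> u =+ v.
Proof.
exact: artin_eq_cancel (@consecutive_sym N) (@consecutive_irr N) _ _ _.
Qed.

Definition seq_pow (T : Type) (w : seq T) (m : nat) : seq T :=
  flatten (nseq m w).

Lemma seq_powS (T : Type) (w : seq T) m : seq_pow w m.+1 = w ++ seq_pow w m.
Proof. by []. Qed.

Lemma seq_powD (T : Type) (w : seq T) a b :
  seq_pow w (a + b) = seq_pow w a ++ seq_pow w b.
Proof. by rewrite /seq_pow nseqD flatten_cat. Qed.

Section FullTwist.
Variable k : nat.
Implicit Types (i : 'I_k.+1) (u t : seq 'I_k.+1).

Local Notation s := (@inord k).

Definition coxeter_word : seq 'I_k.+1 := map s (iota 0 k.+1).

Lemma all_far_inord a b r : a <= k -> b + r <= k.+1 ->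
  (b + r < a) || (a.+1 < b) ->
  all (far (@consecutive k.+1) (s a)) (map s (iota b r)).
Proof.
move=> ak brk ab; apply/allP => _ /mapP[c + ->]; rewrite mem_iota => bc.
by rewrite /far /consecutive -val_eqE /= !inordK; lia.
Qed.

Lemma coxeter_word_shift a t : a < k ->
  coxeter_word ++ s a :: t =+ s a.+1 :: coxeter_word ++ t.
Proof.
move=> ak; have adj_a : consecutive (s a) (s a.+1).
  by rewrite /consecutive !inordK ?eqxx //; lia.
have -> : coxeter_word =
    map s (iota 0 a) ++ [:: s a, s a.+1 & map s (iota a.+2 (k.-1 - a))].
  rewrite /coxeter_word -(map_cat s _ (iota a (2 + (k.-1 - a)))) -iotaD.
  by congr (map s (iota 0 _)); lia.
rewrite -!catA /= -(@artin_eq_far_cat _ _ _ (map s (iota a.+2 _))).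
  rewrite (artin_braid _ adj_a) -artin_eq_far_cat //.
  by apply: all_far_inord; lia.
by apply: all_far_inord; lia.
Qed.

Lemma coxeter_word_shift_iota a r t : a + r <= k ->
  coxeter_word ++ map s (iota a r) ++ t =+
    map s (iota a.+1 r) ++ coxeter_word ++ t.
Proof.
elim: r a => // r IH a ark.
rewrite -[iota a _]/(a :: iota a.+1 r) map_cons cat_cons.
by rewrite coxeter_word_shift ?IH //; lia.
Qed.

Lemma coxeter_pow_shift a r t : a + r <= k ->
  seq_pow coxeter_word r ++ s a :: t =+
    s (a + r) :: seq_pow coxeter_word r ++ t.
Proof.
elim: r a => [|r IH] a ark; first by rewrite addn0.
rewrite !seq_powS -!catA IH; last by lia.
by rewrite coxeter_word_shift ?addnS //; lia.
Qed.

Lemma coxeter_square_shift t :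
  seq_pow coxeter_word 2 ++ s k :: t =+ s 0 :: seq_pow coxeter_word 2 ++ t.
Proof.
have coxeter_rcons : coxeter_word = map s (iota 0 k) ++ [:: s k].
  by rewrite -(map_cat s _ [:: k]) -[[:: k]]/(iota (0 + k) 1) -iotaD addn1.
rewrite !seq_powS cats0 -!catA; symmetry.
by rewrite {2}coxeter_rcons -catA coxeter_word_shift_iota.
Qed.

Definition full_twist : seq 'I_k.+1 := seq_pow coxeter_word k.+2.

(* Since [coxeter_word ^ i] conjugates the first generator to [i], the letter
   [i] can be pulled to the front of [coxeter_word ^ i.+1]. *)
Definition full_twist_div i : seq 'I_k.+1 :=
  seq_pow coxeter_word i ++ map s (iota 1 k) ++ seq_pow coxeter_word (k.+1 - i).

Lemma full_twist_central_gen i t : full_twist ++ i :: t =+ i :: full_twist ++ t.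
Proof.
have ik : i <= k by rewrite -ltnS.
have {1}-> : i = s i by rewrite inord_val.
have twistE : full_twist =
    seq_pow coxeter_word i ++ seq_pow coxeter_word 2 ++
      seq_pow coxeter_word (k - i).
  by rewrite -!seq_powD /full_twist; congr seq_pow; lia.
rewrite twistE -!(catA (seq_pow _ _)) coxeter_pow_shift ?subnKC //.
rewrite coxeter_square_shift.
by rewrite coxeter_pow_shift // add0n inord_val.
Qed.

Definition twists (m : nat) : seq 'I_k.+1 := seq_pow full_twist m.

Lemma twistsCA m u t : twists m ++ u ++ t =+ u ++ twists m ++ t.
Proof.
elim: u => //= i u <-; elim: m => // m IH.
by rewrite /twists seq_powS -!(catA full_twist) IH full_twist_central_gen.
Qed.

Lemma full_twist_divl i t : i :: full_twist_div i ++ t =+ full_twist ++ t.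
Proof.
have ik : i <= k by rewrite -ltnS.
have twistE : full_twist =
    seq_pow coxeter_word i ++ coxeter_word ++ seq_pow coxeter_word (k.+1 - i).
  by rewrite -seq_powS -seq_powD /full_twist; congr seq_pow; lia.
rewrite twistE /full_twist_div -!catA [coxeter_word ++ _]/=.
by rewrite coxeter_pow_shift // add0n inord_val.
Qed.

Lemma full_twist_divr i t : full_twist_div i ++ i :: t =+ full_twist ++ t.
Proof.
apply: (@positive_braid_cancel _ [:: i]) => /=.
by rewrite full_twist_divl full_twist_central_gen.
Qed.

End FullTwist.

Notation "u =b v" := (braid_eq u v) (at level 70).

#[local] Hint Resolve be_refl : core.

#[export] Instance braid_eq_equiv n : Equivalence (@braid_eq n).
Proof. split; [exact: be_refl | exact: be_sym | exact: be_trans]. Qed.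

#[export] Instance cat_braid_eq n :
  Proper (@braid_eq n ==> @braid_eq n ==> @braid_eq n) (@cat (letter n)).
Proof. by move=> u u' uu' v v' vv'; apply: be_cat. Qed.

#[export] Instance cons_braid_eq n :
  Proper (eq ==> @braid_eq n ==> @braid_eq n) (@cons (letter n)).
Proof. by move=> x _ <- u v uv; apply: (be_cat (be_refl [:: x])). Qed.

Lemma inv_letterK n : involutive (@inv_letter n).
Proof. by case=> i b; rewrite /inv_letter /= negbK. Qed.

Lemma inv_wordK n : involutive (@inv_word n).
Proof. by move=> w; rewrite /inv_word map_rev revK (mapK (@inv_letterK n)). Qed.

Lemma braid_mulKV n (w u : word n) : w ++ inv_word w ++ u =b u.
Proof.
elim: w u => //= x w IH u; rewrite /inv_word map_cons rev_cons cat_rcons.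
rewrite -cat1s IH; exact: (be_cat (be_free x) (be_refl u)).
Qed.

Lemma braid_mulK n (w u : word n) : inv_word w ++ w ++ u =b u.
Proof. by rewrite -{2}[w]inv_wordK braid_mulKV. Qed.

Lemma braid_eq_cancel n (w u v : word n) : w ++ u =b w ++ v -> u =b v.
Proof. by move=> uv; rewrite -(braid_mulK w u) uv braid_mulK. Qed.

Definition pos_word n (u : seq 'I_n.-1) : word n := [seq (i, false) | i <- u].

Lemma pos_word_cat n (u v : seq 'I_n.-1) :
  pos_word (u ++ v) = pos_word u ++ pos_word v.
Proof. exact: map_cat. Qed.

Lemma pos_word_braid_eq n (u v : seq 'I_n.-1) :
  u =+ v -> pos_word u =b pos_word v.
Proof.
elim=> {u v} [u|u v _ ?|u v t _ ? _ ?|i u v _ uv|i j u ij|i j u ij] /=.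
- by [].
- by symmetry.
- by transitivity (pos_word v).
- exact: cons_braid_eq.
- apply: (@be_cat _ [:: _; _] [:: _; _] _ _ _ (be_refl _)); apply: be_comm.
  by move: ij; rewrite /far /consecutive -val_eqE /=; lia.
- apply: (@be_cat _ [:: _; _; _] [:: _; _; _] _ _ _ (be_refl _)).
  by case/orP: ij => /eqP ij; [|symmetry]; apply: be_braid.
Qed.

Section Embedding.
Variable k : nat.
Local Notation n := k.+2.
Local Notation pos_word := (@pos_word n).
Local Notation twists := (twists k).
Implicit Types (u v w : word n).

Definition neg_count w : nat := count snd w.

(* The product of [w] with the [neg_count w]-th power of the full twist. *)
Definition pos_part w : seq 'I_k.+1 :=
  flatten [seq if x.2 then full_twist_div x.1 else [:: x.1] | x <- w].

Lemma neg_count_cat u v : neg_count (u ++ v) = neg_count u + neg_count v.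
Proof. exact: count_cat. Qed.

Lemma pos_part_cat u v : pos_part (u ++ v) = pos_part u ++ pos_part v.
Proof. by rewrite /pos_part map_cat flatten_cat. Qed.

Lemma neg_count_pos_word (u : seq 'I_k.+1) : neg_count (pos_word u) = 0.
Proof. by rewrite /neg_count count_map count_pred0. Qed.

Lemma pos_part_pos_word (u : seq 'I_k.+1) : pos_part (pos_word u) = u.
Proof. by rewrite /pos_part -map_comp; exact: flatten_seq1. Qed.

Lemma pos_part_braid_eq u v : u =b v ->
  twists (neg_count v) ++ pos_part u =+ twists (neg_count u) ++ pos_part v.
Proof.
elim=> {u v} [u|u v _ ?|u v w _ uv _ vw|u u' v v' _ uu' _ vv'
    |[i b]|i j ij|i j ij].
- by [].
- by symmetry.
- apply: (@positive_braid_cancel _ (twists (neg_count v))).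
  by rewrite twistsCA uv twistsCA vw twistsCA.
- rewrite !neg_count_cat !pos_part_cat /twists !seq_powD -!/(twists _) -!catA.
  rewrite (twistsCA (neg_count v')) vv' catA uu' -!catA.
  by rewrite (twistsCA (neg_count v)).
- by case: b; rewrite /twists /seq_pow /pos_part /= !cats0 -[X in _ =+ X]cats0;
    [apply: full_twist_divr | rewrite -full_twist_divl cats0].
- by apply: artin_comm; move: ij; rewrite /far /consecutive -val_eqE /=; lia.
- by apply: artin_braid; rewrite /consecutive ij eqxx.
Qed.

Lemma twists_pos_part w :
  pos_word (twists (neg_count w)) ++ w =b pos_word (pos_part w).
Proof.
elim: w => // -[i []] w IH.
  have twistsE : twists (neg_count w).+1 =+
      full_twist_div i ++ twists (neg_count w) ++ [:: i].
    by rewrite (twistsCA _ [:: i]) cats0 full_twist_divr.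
  have iV : pos_word [:: i] ++ (i, true) :: w =b w.
    exact: (be_cat (be_free (i, false)) (be_refl w)).
  rewrite -[neg_count _]/(neg_count w).+1 (pos_word_braid_eq (n := n) twistsE).
  rewrite (@pos_word_cat n (full_twist_div i)) (@pos_word_cat n (twists _)).
  by rewrite -!catA iV IH -pos_word_cat.
have twistsC : twists (neg_count w) ++ [:: i] =+ i :: twists (neg_count w).
  by rewrite (twistsCA _ [:: i]) cats0.
rewrite -[neg_count _]/(neg_count w) -[(i, false) :: w]/(pos_word [:: i] ++ w).
rewrite catA -pos_word_cat (pos_word_braid_eq (n := n) twistsC).
exact: cons_braid_eq.
Qed.

Lemma pos_word_inj (u v : seq 'I_k.+1) : pos_word u =b pos_word v -> u =+ v.
Proof.
by move/pos_part_braid_eq; rewrite !neg_count_pos_word !pos_part_pos_word.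
Qed.

(* Multiplying [q] by a central power of the full twist makes it positive. *)
Lemma braid_eq_conj_pow (q : word n) (i j : 'I_n.-1) m : 0 < m ->
  nseq m (i, false) ++ q =b q ++ nseq m (j, false) ->
  (i, false) :: q =b q ++ [:: (j, false)].
Proof.
move=> m_gt0 iq; set z := pos_word (twists (neg_count q)).
have zC (u : seq 'I_k.+1) : z ++ pos_word u =b pos_word u ++ z.
  rewrite -!pos_word_cat; apply: pos_word_braid_eq.
  by have := twistsCA (neg_count q) u [::]; rewrite !cats0.
have conj_pos (u v : seq 'I_k.+1) : pos_word u ++ q =b q ++ pos_word v <->
    u ++ pos_part q =+ pos_part q ++ v.
  split=> [uv|/(@pos_word_braid_eq n)].
    apply: pos_word_inj; rewrite !pos_word_cat -twists_pos_part.
    by rewrite catA -zC -!catA uv.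
  rewrite !pos_word_cat -twists_pos_part catA -zC -!catA.
  exact: braid_eq_cancel.
apply/(conj_pos [:: i] [:: j])/(artin_eq_conj_pow _ _ m_gt0) => //.
- exact: consecutive_sym.
- exact: consecutive_irr.
- by apply/(conj_pos (nseq m i) (nseq m j)); rewrite /pos_word !map_nseq.
Qed.

End Embedding.

Lemma word_pow_conj n (h q : word n) x m : h =b inv_word q ++ x :: q ->
  word_pow h m =b inv_word q ++ nseq m x ++ q.
Proof.
move=> hE; elim: m => [|m IH].
  by rewrite -[X in _ =b _ ++ X]cats0 braid_mulK.
rewrite -[word_pow h m.+1]/(h ++ word_pow h m) IH hE -!catA /=.
by rewrite braid_mulKV.
Qed.

Lemma conj_braid_eq n (a b p q : word n) :
  inv_word p ++ a ++ p =b inv_word q ++ b ++ q <->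
  a ++ p ++ inv_word q =b (p ++ inv_word q) ++ b.
Proof.
split=> ab.
  apply: (@braid_eq_cancel _ (inv_word p)); rewrite -(catA p) braid_mulK.
  rewrite (catA a) (catA (inv_word p)) ab -!catA.
  by rewrite -[X in b ++ q ++ X]cats0 braid_mulKV cats0.
rewrite -[X in a ++ X]cats0 -(braid_mulK q [::]) cats0.
by rewrite (catA p) (catA a) ab -!catA braid_mulK.
Qed.

Theorem theorem2p11 (n : nat) (hn : 2 <= n) (m : nat) (hm : 1 <= m)
  (H1 H2 : word n) :
  is_half_twist H1 -> is_half_twist H2 ->
  braid_eq (word_pow H1 m) (word_pow H2 m) -> braid_eq H1 H2.
Proof.
case: n hn H1 H2 => [|[|k]] // _ H1 H2 [i [p [_ H1E]]] [j [q [_ H2E]]].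
rewrite (word_pow_conj m H1E) (word_pow_conj m H2E) H1E H2E.
move=> /conj_braid_eq pow_eq.
exact/conj_braid_eq/(braid_eq_conj_pow hm).
Qed.
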